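(* Let $A\in\mathbb M_m$ be a Perron-like matrix with principal eigenvalue $s=s(A)$, and let $\{v_i\}_{i\in J}$ be a basis of $\mathbb R^m$. Put $y_i=\Pi_1v_i$, $x_i(t)=e^{tA}v_i$, $X(t)=[x_i(t)]_{i\in J}$ and $Q_Y(t)=[Q_{y_i}(t)]_{i\in J}$. Then there exist constants $B_0,\delta>0$ such that $$\left\|\frac{x_i(t)}{\|X(t)\|}-\frac{Q_{y_i}(t)}{\|Q_Y(t)\|}\right\|\le B_0e^{-\delta t}\qquad\text{for all } t\ge 1,\ i\in J.$$
   Context: $J=\{1,\dots,m\}$. $\mathbb M_m$ is the space of real $m\times m$ matrices; $[\alpha_i]_{i\in J}$ denotes the matrix with columns $\alpha_i$. $\mathbb R^m$ carries the Euclidean inner product and norm; on $\mathbb M_m$, $\langle[\alpha_i],[\beta_i]\rangle=\sum_{i\in J}\langle\alpha_i,\beta_i\rangle$ and $\|M\|=\langle M,M\rangle^{1/2}$. $\sigma(A)$ is the set of (complex) eigenvalues of $A$, $s(A)=\max\{\mathrm{Re}\,\mu:\mu\in\sigma(A)\}$. $A$ is Perron-like if $s:=s(A)\in\sigma(A)$ and $\mathrm{Re}\,\mu<s$ for all $\mu\in\sigma(A)\setminus\{s\}$; $s$ is then called the principal eigenvalue. $\mathrm{GE}_s(A)=\{\xi\in\mathbb R^m:(A-sI)^k\xi=0\text{ for some }k\ge1\}$. For any $\mu\in\sigma(A)$, $\mathrm{GE}_\mu(A)\subset\mathbb R^m$ is the set of all real and imaginary parts of vectors $u\in\mathbb C^m$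 with $(A-\mu I)^ku=0$ for some $k\ge1$. Then $\mathbb R^m=E_1\oplus E_2$ with $E_1=\mathrm{GE}_s(A)$, $E_2=\sum_{\mu\in\sigma(A)\setminus\{s\}}\mathrm{GE}_\mu(A)$, and $\Pi_1$ is the projection onto $E_1$ along $E_2$. For $0\ne\xi\in\mathrm{GE}_s(A)$, $\mathrm{Ord}(\xi)$ is the smallest $\nu\ge1$ with $(A-sI)^\nu\xi=0$. The characteristic polynomial of $\xi\in \mathrm{GE}_s(A)$ is $Q_\xi(t)=\sum_{k=0}^{\mathrm{Ord}(\xi)-1}\frac{t^k}{k!}(A-sI)^k\xi$ (with $Q_0=0$); equivalently $Q_\xi(t)=e^{t(A-sI)}\xi$. *)

(* Defs.v *)
From HB Require Import structures.
From mathcomp Require Import all_boot all_order all_algebra.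
From mathcomp Require Import complex.
From mathcomp Require Import all_classical all_reals all_analysis.

Set Implicit Arguments.
Unset Strict Implicit.
Unset Printing Implicit Defensive.

Import Order.TTheory GRing.Theory Num.Theory.
Import numFieldNormedType.Exports.

Local Open Scope classical_set_scope.
Local Open Scope ring_scope.
Local Open Scope complex_scope.

Section Euclid.
Variables (R : realType) (m : nat).

Definition of_cols (a : 'I_m -> 'cV[R]_m) : 'M[R]_m :=
  \matrix_(i, j) a j i 0.

Definition dotv (x y : 'cV[R]_m) : R := \sum_(i < m) x i 0 * y i 0.

Definition normv (x : 'cV[R]_m) : R := Num.sqrt (dotv x x).

Definition dotM (M N : 'M[R]_m) : R := \sum_(i < m) dotv (col i M) (col i N).

(* The library's norm `|M| on matrices is the sup norm of the entries. *)
Definition normM (M : 'M[R]_m) : R := Num.sqrt (dotM M M).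

(* The limit is taken for the sup norm, i.e. entrywise. *)
Definition expmx (M : 'M[R]_m) : 'M[R]_m :=
  limn (series (fun k => k`!%:R^-1 *: M ^+ k)).

End Euclid.

Section PerronLike.
Variables (R : realType) (m : nat) (A : 'M[R]_m).

Definition cmx : 'M[R[i]]_m := map_mx (real_complex R) A.

(* [eigenvalue] refers to row eigenvectors; as a set of scalars this is also
   the set of eigenvalues for column eigenvectors. *)
Definition spectrum : set R[i] := [set mu | eigenvalue cmx mu].

(* The spectrum is finite, and nonempty when 0 < m, so that this supremum is a
   maximum. *)
Definition spectral_bound : R := sup [set complex.Re mu | mu in spectrum].

(* This forces 0 < m, since a 0 x 0 matrix has no eigenvalue. *)
Definition perron_like : Prop :=
  spectrum spectral_bound%:C /\
  forall mu, spectrum mu -> mu != spectral_bound%:C ->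
    complex.Re mu < spectral_bound.

Definition GE_real (s : R) : set 'cV[R]_m :=
  [set xi | exists2 k, (0 < k)%N & (A - s%:M) ^+ k *m xi = 0].

Definition GE_complex (mu : R[i]) : set 'cV[R]_m :=
  [set x | exists u : 'cV[R[i]]_m,
     (exists2 k, (0 < k)%N & (cmx - mu%:M) ^+ k *m u = 0) /\
     (x = map_mx (@complex.Re R) u \/ x = map_mx (@complex.Im R) u)].

Definition E1 : set 'cV[R]_m := GE_real spectral_bound.

Definition E2 : set 'cV[R]_m :=
  let D := spectrum `\ spectral_bound%:C in
  [set x | exists2 w : R[i] -> 'cV[R]_m,
     (forall mu, D mu -> GE_complex mu (w mu)) & x = \sum_(mu \in D) w mu].

(* As R^m is the direct sum of E1 and E2, the set below is a singleton and the
   default value 0 is never used. *)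
Definition Pi1 (x : 'cV[R]_m) : 'cV[R]_m :=
  xget 0 [set y | E1 y /\ E2 (x - y)].

(* The default value 0 is used only for vectors outside E1. *)
Definition Ord (xi : 'cV[R]_m) : nat :=
  let P nu := (0 < nu)%N /\ (A - spectral_bound%:M) ^+ nu *m xi = 0 in
  xget 0%N [set nu | P nu /\ forall nu', P nu' -> (nu <= nu')%N].

Definition charQ (xi : 'cV[R]_m) (t : R) : 'cV[R]_m :=
  if xi == 0 then 0 else
  \sum_(k < Ord xi)
    (t ^+ k / k`!%:R) *: ((A - spectral_bound%:M) ^+ k *m xi).

End PerronLike.

(* Main.v *)
Require Import Defs.
From mathcomp Require Import all_boot all_order all_algebra.
From mathcomp Require Import complex.
From mathcomp Require Import all_classical all_reals all_analysis.
From mathcomp Require Import ring lra.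

(* After rescaling by e^{-st}, x_i(t) becomes Q_{y_i}(t) + z_i(t) with
   z_i(t) = e^{-st} e^{tA} (v_i - y_i). The spectral gap makes z_i decay
   exponentially: on a complex generalized eigenspace this follows from an energy
   inequality for |e^{tA} u|^2, by induction on the nilpotency order of u.
   A left eigenvector l for s annihilates E_2, so l Q_{y_i}(t) = l v_i is constant
   in t and nonzero for some i; hence ||Q_Y(t)|| is bounded below. Finally
   f_i / ||F|| and g_i / ||G|| differ by at most 2 ||F - G|| / ||G||. *)

Set Implicit Arguments.
Unset Strict Implicit.
Unset Printing Implicit Defensive.

Import Order.TTheory GRing.Theory Num.Theory.
Import numFieldNormedType.Exports.

Local Open Scope ring_scope.

(** * The matrix exponential as a power series *)

(** A neighbourhood of a matrix contains a product of neighbourhoods of its entries, and finitely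
    many eventual conditions hold jointly. *)
Lemma cvg_mx_entry (T : topologicalType) (m n : nat) (u : nat -> 'M[T]_(m, n))
    (M : 'M[T]_(m, n)) :
  (forall i j, (fun k => u k i j) @ \oo --> M i j)%classic ->
  (u @ \oo --> M)%classic.
Proof.
move=> uM B [P MP PB]; apply: filterS PB _ => /=.
near=> k => i j; move: i j; near: k.
by apply: filter_forall => i; apply: filter_forall => j; exact: uM.
Unshelve. all: by end_near. Qed.

(** The sum of all [|A i j|] dominates each column sum, so each further factor [A] enlarges an entry
    bound by at most that sum. *)
Lemma mx_expr_entry_le (R : realFieldType) (m : nat) (A : 'M[R]_m) (k : nat)
    (i j : 'I_m) :
  `|(A ^+ k) i j| <= (\sum_i \sum_j `|A i j|) ^+ k.
Proof.
set K := \sum_i _; elim: k i j => [|k IHk] i j.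
  by rewrite !expr0 mxE; case: eqP => _; rewrite ?normr1 ?normr0.
rewrite exprSr -mulmxE mxE (le_trans (ler_norm_sum _ _ _))//.
have K0 : 0 <= K by do 2 (apply: sumr_ge0 => ? _).
apply: (@le_trans _ _ (K ^+ k * \sum_l `|A l j|)).
  by rewrite mulr_sumr ler_sum// => l _; rewrite normrM ler_wpM2r.
rewrite exprSr ler_wpM2l ?exprn_ge0// ler_sum// => l _.
by rewrite (bigD1 j)//= lerDl sumr_ge0.
Qed.

Lemma scalemx_expr (R : comNzRingType) (m : nat) (a : R) (A : 'M[R]_m) k :
  (a *: A) ^+ k = a ^+ k *: A ^+ k.
Proof.
elim: k => [|k IHk]; first by rewrite !expr0 scale1r.
by rewrite !exprS -!mulmxE IHk -scalemxAl -scalemxAr scalerA.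
Qed.

Section MatrixExponential.
Variables (R : realType) (m : nat) (A : 'M[R]_m).

(** Taylor coefficients of the entries of [e^{tA} B]. The free factor [B] makes the family closed
    under differentiation: deriving replaces [B] by [A *m B]. *)
Let coef {n} (B : 'M[R]_(m, n)) i j (k : nat) : R := (A ^+ k *m B) i j / k`!%:R.

Lemma is_cvg_pseries_expmx n (B : 'M[R]_(m, n)) i j (t : R) :
  cvgn (pseries (coef B i j) t).
Proof.
set K := \sum_i \sum_j `|A i j|; set L := \sum_l `|B l j|.
apply: normed_cvg.
have L0 : 0 <= L by exact: sumr_ge0.
have K0 : 0 <= K by do 2 (apply: sumr_ge0 => ? _).
(* The terms are dominated by [L] times the exponential series at [K * |t|]. *)
have := @is_cvg_seriesZ _ _ L (is_cvg_series_exp_coeff (K * `|t|)).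
apply: series_le_cvg => [k|k|k].
- exact: normr_ge0.
- by rewrite mulr_ge0// exp_coeff_ge0// mulr_ge0.
rewrite /coef /= !normrM normfV normr_nat normrX.
rewrite [leRHS](_ : _ = L * (K ^+ k * `|t| ^+ k / k`!%:R)); last by rewrite -exprMn.
rewrite mulrAC [leRHS]mulrA [L * _]mulrA ler_wpM2r ?invr_ge0//
  ler_wpM2r ?exprn_ge0//.
rewrite mxE (le_trans (ler_norm_sum _ _ _))// mulr_suml ler_sum// => l _.
by rewrite normrM mulrC ler_wpM2l// mx_expr_entry_le.
Qed.

Lemma pseries_diffs_expmx n (B : 'M[R]_(m, n)) i j :
  pseries_diffs (coef B i j) = coef (A *m B) i j.
Proof.
apply/funext => k; rewrite /pseries_diffs /coef exprSr -mulmxE -mulmxA.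
rewrite factS natrM invfM mulrCA [X in _ * X]mulrA mulfV ?pnatr_eq0//.
by rewrite mul1r.
Qed.

Lemma expmx_entry (t : R) i j :
  expmx (t *: A) i j = limn (pseries (coef 1%:M i j) t).
Proof.
have -> : expmx (t *: A) = \matrix_(i, j) limn (pseries (coef 1%:M i j) t).
  apply/cvg_lim; first exact: norm_hausdorff.
  apply: cvg_mx_entry => {}i {}j; rewrite mxE.
  rewrite (_ : (fun k => _) = pseries (coef 1%:M i j) t).
    exact: is_cvg_pseries_expmx.
  apply/funext => N.
  rewrite /pseries /series/= summxE; apply: eq_bigr => k _.
  by rewrite /coef mulmx1 scalemx_expr !mxE; ring.
by rewrite mxE.
Qed.

Lemma expmx_mulE n (B : 'M[R]_(m, n)) (t : R) i j :
  (expmx (t *: A) *m B) i j = limn (pseries (coef B i j) t).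
Proof.
apply/esym/cvg_lim; first exact: norm_hausdorff.
rewrite (_ : pseries _ _ =
  (fun N => \sum_l pseries (coef 1%:M i l) t N * B l j)); last first.
  apply/funext => N; rewrite /pseries /series /=.
  under [RHS]eq_bigr do rewrite mulr_suml.
  rewrite exchange_big/=; apply: eq_bigr => k _.
  rewrite /coef mxE !mulr_suml; apply: eq_bigr => l _.
  by rewrite /coef mulmx1; ring.
rewrite [X in (_ --> X)%classic]mxE.
apply: cvg_big => [|l _]; first exact: add_continuous.
apply: cvgMr_tmp; rewrite expmx_entry.
exact: is_cvg_pseries_expmx.
Qed.

Lemma is_derive_expmx_mul n (B : 'M[R]_(m, n)) (t : R) i j :
  is_derive t 1 (fun t : R => (expmx (t *: A) *m B) i j)
    ((expmx (t *: A) *m (A *m B)) i j).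
Proof.
rewrite (_ : (fun t => _) = (fun t : R => limn (pseries (coef B i j) t))).
  rewrite expmx_mulE -pseries_diffs_expmx.
  (* Termwise differentiation asks for convergence of the series and of its first two formal
     derivatives at a point of modulus above [|t|]; all three are series of the same family, with
     [B], [A B] and [A A B]. *)
  apply: (@pseries_snd_diffs _ _ (`|t| + 1)); rewrite ?pseries_diffs_expmx.
  - exact: is_cvg_pseries_expmx.
  - exact: is_cvg_pseries_expmx.
  - exact: is_cvg_pseries_expmx.
  - by rewrite [ltRHS]ger0_norm ?addr_ge0// ltrDl.
by apply/funext => x; exact: expmx_mulE.
Qed.

Lemma expmx0 : expmx (0 *: A) = 1%:M.
Proof.
apply/matrixP => i j; rewrite expmx_entry.
apply/cvg_lim; first exact: norm_hausdorff.
(* The empty partial sum is [0]; the sequence is constant only from index one on, hence the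
   shift. *)
rewrite -(cvg_shiftS _)/=; apply: cvg_near_cst; apply: nearW => N.
rewrite /pseries /series/= big_nat_recl// big1 ?addr0; last first.
  by move=> k _; rewrite expr0n mulr0.
by rewrite /coef expr0 mulmx1 fact0 divr1 mulr1.
Qed.

End MatrixExponential.

(** * Decay on generalized eigenspaces *)

Section RealImaginaryParts.
Variables (R : realType) (m : nat) (A : 'M[R]_m).

Lemma map_Re_cmx_mul (u : 'cV[R[i]%C]_m) :
  map_mx (@complex.Re R) (cmx A *m u) = A *m map_mx (@complex.Re R) u.
Proof.
apply/matrixP => i j; rewrite !mxE raddf_sum; apply: eq_bigr => l _.
by rewrite !mxE; case: (u l j) => a b /=; rewrite mul0r subr0.
Qed.

Lemma map_Im_cmx_mul (u : 'cV[R[i]%C]_m) :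
  map_mx (@complex.Im R) (cmx A *m u) = A *m map_mx (@complex.Im R) u.
Proof.
apply/matrixP => i j; rewrite !mxE raddf_sum; apply: eq_bigr => l _.
by rewrite !mxE; case: (u l j) => a b /=; rewrite mul0r addr0.
Qed.

Lemma map_Re_scale (z : R[i]%C) (u : 'cV[R[i]%C]_m) :
  map_mx (@complex.Re R) (z *: u) =
  complex.Re z *: map_mx (@complex.Re R) u
  - complex.Im z *: map_mx (@complex.Im R) u.
Proof.
by apply/matrixP => i j; rewrite !mxE; case: z (u i j) => [a b] [c d].
Qed.

Lemma map_Im_scale (z : R[i]%C) (u : 'cV[R[i]%C]_m) :
  map_mx (@complex.Im R) (z *: u) =
  complex.Re z *: map_mx (@complex.Im R) u
  + complex.Im z *: map_mx (@complex.Re R) u.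
Proof.
by apply/matrixP => i j; rewrite !mxE; case: z (u i j) => [a b] [c d].
Qed.

End RealImaginaryParts.

Section DifferentialInequalities.
Variable R : realType.
Implicit Types f g : R -> R.

Lemma derive_le0_le_init f f' :
  (forall t, is_derive t (1 : R) f (f' t)) -> (forall t, 0 <= t -> f' t <= 0) ->
  forall t, 0 <= t -> f t <= f 0.
Proof.
move=> df f'0 t t0.
have cf : {within `[0, t], continuous f}%classic.
  apply: continuous_subspaceT => x; apply: differentiable_continuous.
  by apply/derivable1_diffP; have [] := df x.
apply: (ler0_derive1_le_cc _ _ cf); rewrite ?in_itv/= ?lexx ?t0//.
move=> x; rewrite in_itv/= => /andP[/ltW x0 _].
by rewrite derive1E; have [_ ->] := df x; exact: f'0.
Qed.

Lemma is_derive_expR_scale (k t : R) :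
  is_derive t (1 : R) (fun t => expR (k * t)) (k * expR (k * t)).
Proof.
have dk : is_derive t (1 : R) (fun t => k * t) k.
  by apply: is_derive_eq; rewrite /GRing.scale/= mulr1.
by have := is_derive1_comp (is_derive_expR (k * t)) dk; rewrite mulrC.
Qed.

(** Multiplying by [e^{-ct}] gives [(e^{-ct} g)' <= K e^{(b-c)t}]. Subtracting the antiderivative
    [L e^{(b-c)t}] of the right side leaves a nonincreasing function [f], and [c < b] lets [e^{ct}]
    be absorbed into [e^{bt}]. *)
Lemma gronwall_expR g g' (b c K : R) :
  c < b -> 0 <= K -> (forall t, is_derive t (1 : R) g (g' t)) ->
  (forall t, 0 <= t -> g' t <= c * g t + K * expR (b * t)) ->
  exists2 C, 0 <= C & forall t, 0 <= t -> g t <= C * expR (b * t).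
Proof.
move=> cb K0 dg g'le; set L := K / (b - c).
have bc0 : 0 < b - c by rewrite subr_gt0.
have L0 : 0 <= L by rewrite divr_ge0// ltW.
pose f t := expR (- c * t) * g t - L * expR ((b - c) * t).
pose f' t := expR (- c * t) * (g' t - c * g t) - K * expR ((b - c) * t).
have df t : is_derive t (1 : R) f (f' t).
  have d1 := is_derive_expR_scale (- c) t.
  have d2 := is_derive_expR_scale (b - c) t.
  have d3 := dg t.
  apply: is_derive_eq; rewrite /f' /L /GRing.scale/=.
  by field; rewrite gt_eqF.
have f'0 t : 0 <= t -> f' t <= 0.
  move=> t0; rewrite /f' subr_le0.
  rewrite (_ : (b - c) * t = - c * t + b * t); last by ring.
  rewrite expRD mulrCA ler_wpM2l ?expR_ge0// lerBlDl; exact: g'le.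
exists (`|g 0| + L) => [|t t0]; first by rewrite addr_ge0.
have := derive_le0_le_init df f'0 t0.
rewrite /f !mulr0 expR0 mul1r mulr1.
rewrite lerBlDr -(ler_pM2l (expR_gt0 (c * t))) mulrA -expRD mulNr subrr expR0 mul1r.
move=> /le_trans; apply.
rewrite mulrDr mulrCA -expRD (_ : c * t + (b - c) * t = b * t); last by ring.
rewrite mulrDl lerD2r.
apply: (@le_trans _ _ (expR (c * t) * `|g 0|)).
  by rewrite ler_wpM2l ?expR_ge0// (le_trans _ (ler_norm _))// gerBl.
by rewrite mulrC ler_wpM2l// ler_expR ler_wpM2r// ltW.
Qed.

End DifferentialInequalities.

Section InnerProduct.
Variables (R : realType) (m : nat).
Implicit Types x y : 'cV[R]_m.

Lemma dotvDr x y z : dotv x (y + z) = dotv x y + dotv x z.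
Proof. by rewrite /dotv -big_split; apply: eq_bigr => i _; rewrite mxE mulrDr. Qed.

Lemma dotvZr a x y : dotv x (a *: y) = a * dotv x y.
Proof.
by rewrite /dotv mulr_sumr; apply: eq_bigr => i _; rewrite mxE mulrCA.
Qed.

Lemma dotvC x y : dotv x y = dotv y x.
Proof. by apply: eq_bigr => i _; rewrite mulrC. Qed.

Lemma dotv_ge0 x : 0 <= dotv x x.
Proof. by apply: sumr_ge0 => i _; rewrite -expr2 sqr_ge0. Qed.

(** Divide [0 <= (e x_i - y_i)^2] by [e] and sum over [i]. *)
Lemma dotv_young (e : R) x y :
  0 < e -> 2 * dotv x y <= e * dotv x x + dotv y y / e.
Proof.
move=> e0; rewrite /dotv !mulr_sumr mulr_suml -big_split ler_sum//= => i _.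
have e1 : e * e^-1 = 1 by rewrite mulfV// gt_eqF.
have : 0 <= e^-1 * (e * x i 0 - y i 0) ^+ 2.
  by rewrite mulr_ge0 ?sqr_ge0// invr_ge0 ltW.
rewrite -subr_ge0; congr (0 <= _).
by rewrite sqrrB exprMn mulrDr mulrBr; ring: e1.
Qed.

Lemma is_derive_dotv (x : R -> 'cV[R]_m) y (t : R) :
  (forall i, is_derive t (1 : R) (fun t => x t i 0) (y i 0)) ->
  is_derive t (1 : R) (fun t => dotv (x t) (x t)) (2 * dotv (x t) y).
Proof.
move=> dx; rewrite (_ : (fun t => _) =
  \sum_(i < m) (fun t => x t i 0) * (fun t => x t i 0)); last first.
  by apply/funext => s; rewrite fct_sumE.
have d i := is_deriveM (dx i) (dx i).
apply: (is_derive_eq (is_derive_sum d)).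
rewrite /dotv mulr_sumr; apply: eq_bigr => i _.
by rewrite /GRing.scale/= mulr_natl.
Qed.

End InnerProduct.

Section Flow.
Variables (R : realType) (m : nat) (A : 'M[R]_m).

Let F (t : R) : 'M[R]_m := expmx (t *: A).
(** This is [|e^{tA} u|^2] for complex [u]: the real matrix [e^{tA}] acts separately on real and
    imaginary parts, so everything stays over the reals. *)
Let sqn (t : R) (u : 'cV[R[i]%C]_m) : R :=
  dotv (F t *m map_mx (@complex.Re R) u) (F t *m map_mx (@complex.Re R) u) +
  dotv (F t *m map_mx (@complex.Im R) u) (F t *m map_mx (@complex.Im R) u).

(* With [w = F t u], [(A - mu) u = u'] gives
   [d/dt |w|^2 = 2 Re mu |w|^2 + 2 Re <w, F t u'>]; the last term is absorbed
   by Young's inequality and the bound on [u']. *)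
Lemma expmx_geigen_growth (mu : R[i]%C) (b : R) : complex.Re mu < b ->
  forall k (u : 'cV[R[i]%C]_m), (cmx A - mu%:M) ^+ k *m u = 0 ->
  exists2 C, 0 <= C & forall t, 0 <= t -> sqn t u <= C * expR (2 * b * t).
Proof.
move=> mub; set a := complex.Re mu in mub.
have e0 : 0 < b - a by rewrite subr_gt0.
elim=> [|k IHk] u.
  rewrite expr0 mul1mx => ->; exists 0 => // t _.
  have z0 (f : {additive R[i]%C -> R}) : map_mx f (0 : 'cV[R[i]%C]_m) = 0.
    by apply/matrixP => i j; rewrite !mxE raddf0.
  rewrite /sqn (z0 (@complex.Re R)) (z0 (@complex.Im R)) mulmx0.
  by rewrite /dotv !big1 ?addr0 ?mul0r// => i _; rewrite mxE mulr0.
rewrite exprSr -mulmxE -mulmxA; set u' := _ *m u => /IHk[C C0 HC].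
have Auu' : cmx A *m u = u' + mu *: u.
  by rewrite /u' mulmxBl mul_scalar_mx subrK.
pose p := map_mx (@complex.Re R) u; pose q := map_mx (@complex.Im R) u.
pose p' := map_mx (@complex.Re R) u'; pose q' := map_mx (@complex.Im R) u'.
have ReD (v w : 'cV[R[i]%C]_m) : map_mx (@complex.Re R) (v + w) =
    map_mx (@complex.Re R) v + map_mx (@complex.Re R) w.
  by apply/matrixP => i j; rewrite !mxE raddfD.
have ImD (v w : 'cV[R[i]%C]_m) : map_mx (@complex.Im R) (v + w) =
    map_mx (@complex.Im R) v + map_mx (@complex.Im R) w.
  by apply/matrixP => i j; rewrite !mxE raddfD.
have Ap : A *m p = p' + (a *: p - complex.Im mu *: q).
  by rewrite -map_Re_cmx_mul Auu' ReD map_Re_scale.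
have Aq : A *m q = q' + (a *: q + complex.Im mu *: p).
  by rewrite -map_Im_cmx_mul Auu' ImD map_Im_scale.
pose g' t := 2 * dotv (F t *m p) (F t *m (A *m p))
           + 2 * dotv (F t *m q) (F t *m (A *m q)).
have dg t : is_derive t (1 : R) (sqn^~ u) (g' t).
  by apply: is_deriveD; apply: is_derive_dotv => i; exact: is_derive_expmx_mul.
(* Young's inequality with weight [b - a] raises the rate from [2 a] to [a + b], still strictly
   below the target [2 b]. *)
have g'le t : 0 <= t ->
    g' t <= (a + b) * sqn t u + C / (b - a) * expR (2 * b * t).
  move=> t0; have := HC t t0; rewrite /g' /sqn -/p -/q -/p' -/q'.
  rewrite Ap Aq !mulmxDr mulmxN -!scalemxAr !dotvDr -scaleN1r !dotvZr.
  (* With both inner products in the same order, the two [Im mu] terms cancel. *)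
  rewrite (dotvC (F t *m q) (F t *m p)).
  have := dotv_young (F t *m p) (F t *m p') e0.
  have := dotv_young (F t *m q) (F t *m q') e0.
  set pp := dotv _ (F t *m p); set qq := dotv _ (F t *m q).
  move=> yq yp; rewrite -(ler_pM2r (_ : 0 < (b - a)^-1)) ?invr_gt0// => H.
  rewrite mulrAC; lra.
apply: (gronwall_expR _ _ dg g'le); first by lra.
by rewrite divr_ge0// ltW.
Qed.

End Flow.

(** * The principal part *)

Lemma is_derive_monomial (R : realType) (l : nat) (t c : R) :
  is_derive t (1 : R) (fun t => t ^+ l.+1 * c) (l.+1%:R * t ^+ l * c).
Proof.
rewrite (_ : (fun _ => _) = (id ^+ l.+1) * cst c); last first.
  by apply/funext => x; rewrite fctE exprfctE.
by apply: is_derive_eq; rewrite /GRing.scale/= mulr0 add0r mulr1 mulrC.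
Qed.

Section PrincipalPart.
Variables (R : realType) (m : nat) (A : 'M[R]_m).

(** Induction on [k]. With [N = A - s], the derivative of [e^{-st} e^{tA} y] is
    [e^{-st} e^{tA} N y]; the induction hypothesis for [N y] identifies it with the derivative of
    the polynomial [Q]. The difference [D] is therefore constant, and it vanishes at [0]. *)
Lemma expmx_geigen (s : R) k (y : 'cV[R]_m) :
  (A - s%:M) ^+ k *m y = 0 ->
  forall t, expmx (t *: A) *m y =
    expR (s * t) *: \sum_(j < k) (t ^+ j / j`!%:R) *: ((A - s%:M) ^+ j *m y).
Proof.
elim: k y => [|k IHk] y.
  by rewrite expr0 mul1mx => -> t; rewrite mulmx0 big_ord0 scaler0.
rewrite exprSr -mulmxE -mulmxA => /IHk {}IHk t; set N := A - s%:M in IHk *.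
apply/matrixP => i j; rewrite (ord1 j) {j}.
pose Q t := \sum_(l < k.+1) (t ^+ l / l`!%:R) * (N ^+ l *m y) i 0.
pose D t := expR (- s * t) * (expmx (t *: A) *m y) i 0 - Q t.
have dQ x : is_derive x (1 : R) Q
    (\sum_(l < k) (x ^+ l / l`!%:R) * (N ^+ l.+1 *m y) i 0).
  rewrite (_ : Q = cst ((N ^+ 0 *m y) i 0) + \sum_(l < k)
    (fun x => x ^+ l.+1 * ((N ^+ l.+1 *m y) i 0 / (l.+1)`!%:R))); last first.
    apply/funext => x'; rewrite /Q big_ord_recl fctE fct_sumE/=.
    rewrite fact0 divr1 expr0 mul1r.
    by congr (_ + _); apply: eq_bigr => l _; ring.
  apply: (is_derive_eq (is_deriveD _ (is_derive_sum (fun l : 'I_k =>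
    is_derive_monomial l x ((N ^+ l.+1 *m y) i 0 / (l.+1)`!%:R))))).
  rewrite add0r; apply: eq_bigr => l _.
  rewrite factS natrM.
  have f0 : l`!%:R != 0 :> R by rewrite pnatr_eq0 -lt0n fact_gt0.
  have l0 : l.+1%:R != 0 :> R by rewrite pnatr_eq0.
  by field; rewrite f0 addrC natr1 l0.
have dD x : is_derive x (1 : R) D 0.
  have d1 := is_derive_expR_scale (- s) x.
  have d2 := is_derive_expmx_mul A y x i 0.
  have d3 := dQ x.
  apply: is_derive_eq; rewrite /GRing.scale/=.
  have -> : A *m y = N *m y + s *: y by rewrite mulmxBl mul_scalar_mx subrK.
  rewrite mulmxDr -scalemxAr IHk.
  rewrite mxE [X in _ * (X + _)]mxE [X in _ * (_ + X)]mxE mulrDr.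
  rewrite mulrA -expRD mulNr addNr expR0 mul1r summxE.
  under [X in X + _ + _ - _]eq_bigr => l _.
    rewrite mxE mulmxA mulmxE -exprSr.
    over.
  by ring.
have := is_derive_0_is_cst t 0 dD.
rewrite {2}/D mulr0 expR0 mul1r expmx0 mul1mx /Q.
rewrite big_ord_recl big1 => [|l _]; last first.
  by rewrite expr0n/= !mul0r.
rewrite expr0 fact0 divr1 mul1r addr0 expr0 mul1mx subrr => /eqP.
rewrite subr_eq0 => /eqP H; rewrite [RHS]mxE summxE.
transitivity (expR (s * t) * (expR (- s * t) * (expmx (t *: A) *m y) i 0)).
  by rewrite mulrA -expRD mulNr subrr expR0 mul1r.
by rewrite H /Q; congr (_ * _); apply: eq_bigr => l _; rewrite [RHS]mxE.
Qed.

(** On [E1] some positive exponent annihilates [y], so a least one exists and [xget] does not fall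
    back on its default. *)
Lemma Ord_spec (y : 'cV[R]_m) : E1 A y ->
  (0 < Ord A y)%N /\ (A - (spectral_bound A)%:M) ^+ Ord A y *m y = 0.
Proof.
move=> [k k0 ky].
have ex : exists n, (0 < n)%N && ((A - (spectral_bound A)%:M) ^+ n *m y == 0).
  by exists k; rewrite k0 ky eqxx.
rewrite /Ord; set S := (X in xget _ X).
have : exists n, S n.
  case: (ex_minnP ex) => n /andP[n0 /eqP ny] nmin; exists n.
  split=> // n' [n'0 n'y].
  by apply: nmin; rewrite n'0 n'y eqxx.
by move=> /(xgetPex 0%N)[].
Qed.

Lemma expmx_charQ (y : 'cV[R]_m) (t : R) : E1 A y ->
  expmx (t *: A) *m y = expR (spectral_bound A * t) *: charQ A y t.
Proof.
move=> Ey; rewrite /charQ; case: eqP => [->|_]; first by rewrite mulmx0 scaler0.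
by apply: expmx_geigen; have [] := Ord_spec Ey.
Qed.

(** Since [l (A - s) = 0], only the term [k = 0] survives; it is present because [Ord] is
    positive. *)
Lemma left_eigen_charQ (l : 'rV[R]_m) (y : 'cV[R]_m) (t : R) :
  l *m A = spectral_bound A *: l -> E1 A y -> l *m charQ A y t = l *m y.
Proof.
move=> lA Ey; rewrite /charQ; case: eqP => [->|_]; first by rewrite !mulmx0.
have [+ _] := Ord_spec Ey; case: (Ord A y) => // n _.
rewrite big_ord_recl expr0 fact0 divr1 scale1r expr0 mul1mx mulmxDr.
rewrite mulmx_sumr big1 ?addr0// => k _.
rewrite -scalemxAr lift0 (exprS (A - _)) -mulmxE !mulmxA mulmxBr lA.
rewrite mul_mx_scalar subrr.
by rewrite !mul0mx scaler0.
Qed.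

End PrincipalPart.

(** * Spectral splitting *)

Lemma char_poly_tr (R : comNzRingType) (n : nat) (A : 'M[R]_n) :
  char_poly A^T = char_poly A.
Proof.
rewrite /char_poly -det_tr; congr (\det _).
by apply/matrixP => i j; rewrite !mxE eq_sym.
Qed.

Lemma trmx_expr (R : comNzRingType) (n : nat) (A : 'M[R]_n) k :
  (A ^+ k)^T = A^T ^+ k.
Proof.
elim: k => [|k IHk]; first by rewrite !expr0 trmx1.
by rewrite exprS -mulmxE trmx_mul IHk mulmxE -exprSr.
Qed.

(** Primary decomposition. A product of powers of the distinct linear factors is a multiple of the
    characteristic polynomial, so Cayley-Hamilton makes it annihilate the matrix, and the kernels of
    its coprime factors span the space. The transpose is used because [kermxpoly] is a row space. *)
Lemma geigen_decomposition (F : closedFieldType) (n : nat) (C : 'M[F]_n)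
    (u : 'cV[F]_n) :
  exists r : seq F, exists U : 'I_(size r) -> 'cV[F]_n,
    [/\ uniq r, forall a, a \in r = eigenvalue C a,
        u = \sum_i U i &
        forall i, exists2 k, (0 < k)%N &
          (C - (tnth (in_tuple r) i)%:M) ^+ k *m U i = 0].
Proof.
case: n C u => [|n] C u.
  exists [::]; exists (fun _ => 0); split=> //.
  - by move=> a; apply/esym/negbTE/eigenvalueP => -[v _]; rewrite (thinmx0 v) eqxx.
  - by apply/matrixP => -[].
  - by case.
have [r0 r0E] := closed_field_poly_normal (char_poly C).
rewrite (monicP (char_poly_monic C)) scale1r in r0E.
pose r := undup r0; pose a (i : 'I_(size r)) := tnth (in_tuple r) i.
(* One exponent serves all roots: [size r0] bounds every multiplicity, and the successor makes it
   positive. *)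
pose N := (size r0).+1; pose g := C^T.
have a_inj : injective a by exact/tuple_uniqP/undup_uniq.
have pg0 : horner_mx g (\prod_i ('X - (a i)%:P) ^+ N) = 0.
  have /dvdpP[q ->] : char_poly g %| \prod_i ('X - (a i)%:P) ^+ N.
    rewrite char_poly_tr r0E -(big_undup_iterop_count _ r0 xpredT).
    rewrite -(big_tnth _ _ r xpredT (fun z => ('X - z%:P) ^+ N)).
    apply: (big_ind2 (fun p q : {poly F} => p %| q)) => [||z _].
    - exact: dvdpp.
    - by move=> *; exact: dvdp_mul.
    - rewrite -[iterop _ _ _ _]/(_ ^+ _) dvdp_exp2l//.
      by rewrite (leq_trans (count_size _ _)).
  by rewrite rmorphM /= Cayley_Hamilton mulr0.
have cop : {in xpredT &, forall i j, j != i ->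
    coprimep (('X - (a i)%:P) ^+ N) (('X - (a j)%:P) ^+ N)}.
  move=> i j _ _ ij; rewrite coprimep_expr ?coprimep_expl//.
  by rewrite coprimep_XsubC root_XsubC (inj_eq a_inj).
have : (u^T <= \sum_i kermxpoly g (('X - (a i)%:P) ^+ N))%MS.
  rewrite -(kermxpoly_prod g cop) /kermxpoly pg0.
  by apply/sub_kermxP; rewrite mulmx0.
move=> /sub_sumsmxP[V VE].
exists r; exists (fun i => (V i *m kermxpoly g (('X - (a i)%:P) ^+ N))^T); split.
- exact: undup_uniq.
- move=> z; rewrite mem_undup eigenvalue_root_char r0E.
  by rewrite root_prod_XsubC.
- apply: trmx_inj; rewrite VE [RHS]raddf_sum.
  by apply: eq_bigr => i _; rewrite /= trmxK.
- move=> i; exists N => //; apply: trmx_inj.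
  rewrite trmx_mul trmxK trmx0 trmx_expr raddfB/= tr_scalar_mx -/g -/(a i).
  rewrite -mulmxA /kermxpoly rmorphXn/= rmorphB/= horner_mx_X horner_mx_C.
  by rewrite mulmx_ker mulmx0.
Qed.

Section SpectralSplitting.
Variables (R : realType) (m : nat) (A : 'M[R]_m).

Lemma cmxB_scalar (s : R) : cmx A - (s%:C%C)%:M = cmx (A - s%:M).
Proof. by rewrite /cmx map_mxB map_scalar_mx. Qed.

(** For real [s] the matrix [A - s] is real, so its powers commute with taking real parts. *)
Lemma GE_real_Re (s : R) k (u : 'cV[R[i]%C]_m) :
  (0 < k)%N -> (cmx A - (s%:C%C)%:M) ^+ k *m u = 0 ->
  GE_real A s (map_mx (@complex.Re R) u).
Proof.
move=> k0; rewrite cmxB_scalar => Nu; exists k => //.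
have NE l (w : 'cV_m) : map_mx (@complex.Re R) (cmx (A - s%:M) ^+ l *m w) =
    (A - s%:M) ^+ l *m map_mx (@complex.Re R) w.
  elim: l w => [|l IHl] w; first by rewrite !expr0 !mul1mx.
  by rewrite !exprSr -!mulmxE -!mulmxA IHl map_Re_cmx_mul.
by rewrite -NE Nu; apply/matrixP => i j; rewrite !mxE.
Qed.

(** Exhibiting one splitting makes [xget] return a genuine one: decompose the complexification of
    [x] and take real parts of the components. *)
Lemma Pi1_spec (x : 'cV[R]_m) : E1 A (Pi1 A x) /\ E2 A (x - Pi1 A x).
Proof.
suff : exists y, E1 A y /\ E2 A (x - y) by move=> /(xgetPex 0).
have [r [U [r_uniq rE uE UE]]] :=
  geigen_decomposition (cmx A) (map_mx (real_complex R) x).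
set s := spectral_bound A; pose a i := tnth (in_tuple r) i.
have a_inj : injective a by exact/tuple_uniqP.
pose w i := map_mx (@complex.Re R) (U i).
have xE : x = \sum_i w i.
  apply/matrixP => i j; rewrite summxE.
  have := congr1 (fun M : 'cV[R[i]%C]_m => complex.Re (M i j)) uE.
  rewrite mxE /= => ->; rewrite summxE raddf_sum.
  by apply: eq_bigr => l _; rewrite mxE.
(* Components reindexed by eigenvalue, as [E2] requires; by injectivity of [a] the sum has at most
   one term, and it is [0] off the list. *)
pose W mu := \sum_(i | a i == mu) w i.
have Wa i : W (a i) = w i.
  by rewrite /W (big_pred1 i)// => l; rewrite /= (inj_eq a_inj).
exists (W (s%:C)%C); split.
  rewrite /W; have [i /eqP ais|nos] := pickP (fun i => a i == (s%:C)%C).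
    rewrite (big_pred1 i) => [|l]; last by rewrite /= -ais (inj_eq a_inj).
    have [k k0] := UE i; rewrite -/(a i) ais; exact: GE_real_Re.
  by rewrite big_pred0//; exists 1%N => //; rewrite mulmx0.
exists W => [mu|].
  move=> [spmu mus].
  have /tnthP[i muE] : mu \in in_tuple r by rewrite rE.
  have {}muE : mu = a i by [].
  by rewrite muE Wa; exists (U i); split; [exact: UE|left].
rewrite xE (bigID (fun i => a i == (s%:C)%C))/= -/(W _) addrAC subrr add0r.
rewrite (_ : (_ `\ _)%classic =
    [set` [seq mu <- r | mu != (s%:C)%C]]%classic); last first.
  apply/seteqP; split => mu /=; rewrite mem_filter rE => -[].
    by move=> -> /eqP ->.
  by move=> /andP[/eqP ? ?].
rewrite -fsbig_seq ?filter_uniq// big_filter [RHS]big_tnth.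
by apply: eq_bigr => i _; rewrite -/(a i) Wa.
Qed.

(** A real root of the complexified characteristic polynomial is a root of the real one, so the
    eigenvector can be taken real; [eigenvalue] already refers to rows. *)
Lemma perron_like_left_eigenvector : perron_like A ->
  exists2 l : 'rV[R]_m, l != 0 & l *m A = spectral_bound A *: l.
Proof.
move=> [sp _]; have : eigenvalue A (spectral_bound A).
  rewrite eigenvalue_root_char -(fmorph_root (real_complex R)) map_char_poly.
  by rewrite -eigenvalue_root_char.
by move=> /eigenvalueP[l lA l0]; exists l.
Qed.

(** Applying [l] to [(A - mu)^k u = 0] gives [(s - mu)^k l u = 0], hence [l u = 0]. As [l] is real,
    it kills both the real and the imaginary part of [u]. *)
Lemma left_eigen_GE_complex (l : 'rV[R]_m) (s : R) mu (z : 'cV[R]_m) :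
  l *m A = s *: l -> mu != (s%:C)%C -> GE_complex A mu z -> l *m z = 0.
Proof.
move=> lA mus [u [[k _ uk] zE]]; pose L := map_mx (real_complex R) l.
have LA : L *m (cmx A - mu%:M) = ((s%:C)%C - mu) *: L.
  rewrite mulmxBr /L /cmx -map_mxM lA mul_mx_scalar scalerBl.
  by congr (_ - _); apply/matrixP => i j; rewrite !mxE rmorphM.
have LAk j : L *m (cmx A - mu%:M) ^+ j = ((s%:C)%C - mu) ^+ j *: L.
  elim: j => [|j IHj]; first by rewrite !expr0 scale1r mulmx1.
  by rewrite exprSr -mulmxE mulmxA IHj -scalemxAl LA scalerA -exprSr.
have Lu : L *m u = 0.
  have := congr1 (mulmx^~ u) (LAk k).
  rewrite -mulmxA uk mulmx0 -scalemxAl => /esym/eqP.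
  by rewrite scaler_eq0 expf_eq0 subr_eq0 eq_sym (negbTE mus) andbF => /eqP.
apply/matrixP => i j; have := congr1 (fun M : 'cV[R[i]%C]_1 => M i j) Lu.
rewrite !mxE => Lu0; case: zE => ->.
- have := congr1 (@complex.Re R) Lu0; rewrite raddf_sum => E; refine (etrans _ E).
  apply: eq_bigr => p _; rewrite !mxE.
  by case: (u p j) => c d /=; rewrite mul0r subr0.
- have := congr1 (@complex.Im R) Lu0; rewrite raddf_sum => E; refine (etrans _ E).
  apply: eq_bigr => p _; rewrite !mxE.
  by case: (u p j) => c d /=; rewrite mul0r addr0.
Qed.

(** The sum in [E2] runs over a finite support inside the index set (an infinite support gives the
    empty sum), so induction over a finite sum applies. *)
Lemma E2_ind (P : 'cV[R]_m -> Prop) :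
  P 0 -> (forall x y, P x -> P y -> P (x + y)) ->
  (forall mu z, spectrum A mu -> mu != ((spectral_bound A)%:C)%C ->
     GE_complex A mu z -> P z) ->
  forall z, E2 A z -> P z.
Proof.
move=> P0 PD PG z [w wP ->]; rewrite big_seq; apply: (big_ind P) => // mu.
case: finite_supportP => //= X XD _ _ /XD[spmu mus].
by apply: (PG mu) => //; [exact/eqP|exact: wP].
Qed.

End SpectralSplitting.

(** * Euclidean norms of vectors and column families *)

Section EuclideanNorm.
Variables (R : realType) (m : nat).
Implicit Types x y : 'cV[R]_m.

Lemma sqr_normv x : normv x ^+ 2 = dotv x x.
Proof. by rewrite /normv sqr_sqrtr ?dotv_ge0. Qed.

Lemma normv_ge0 x : 0 <= normv x.
Proof. exact: sqrtr_ge0. Qed.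

Lemma normv_entry x i : `|x i 0| <= normv x.
Proof.
rewrite -(@ler_pXn2r _ 2)// ?nnegrE ?normv_ge0// sqr_normv real_normK ?num_real//.
rewrite /dotv (bigD1 i)//= -expr2 lerDl sumr_ge0// => j _.
by rewrite -expr2 sqr_ge0.
Qed.

Lemma normv_eq0 x : normv x = 0 -> x = 0.
Proof.
move=> x0; apply/matrixP => i j; rewrite (ord1 j) mxE; apply/eqP.
by rewrite -normr_le0 -x0 normv_entry.
Qed.

Lemma normvZ a x : normv (a *: x) = `|a| * normv x.
Proof.
rewrite /normv dotvZr dotvC dotvZr mulrA -expr2 sqrtrM ?sqr_ge0//.
by rewrite sqrtr_sqr.
Qed.

Lemma normv0 : normv (0 : 'cV[R]_m) = 0.
Proof. by rewrite -(scale0r 0) normvZ normr0 mul0r. Qed.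

Lemma ler_normvD x y : normv (x + y) <= normv x + normv y.
Proof.
have [/normv_eq0->|x0] := eqVneq (normv x) 0.
  by rewrite add0r lerDr normv_ge0.
have [/normv_eq0->|y0] := eqVneq (normv y) 0.
  by rewrite addr0 lerDl normv_ge0.
have xp : 0 < normv x by rewrite lt0r x0 normv_ge0.
have yp : 0 < normv y by rewrite lt0r y0 normv_ge0.
rewrite -(@ler_pXn2r _ 2) ?nnegrE ?addr_ge0 ?normv_ge0// sqr_normv.
rewrite dotvDr [dotv _ x]dotvC [dotv _ y]dotvC !dotvDr (dotvC y x).
(* The weight [|y| / |x|] turns Young's inequality into Cauchy-Schwarz. *)
have := dotv_young x y (divr_gt0 yp xp).
rewrite -!sqr_normv (_ : _ + _ = 2 * (normv x * normv y)); first by lra.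
by field; rewrite x0 y0.
Qed.

(** This reduces the triangle inequality and homogeneity of the matrix norm to those of [normv]. *)
Lemma normM_of_cols (f : 'I_m -> 'cV[R]_m) :
  normM (of_cols f) = normv (\col_i normv (f i)).
Proof.
rewrite /normM /dotM; congr (Num.sqrt _); apply: eq_bigr => i _.
rewrite !mxE -expr2 sqr_normv.
suff -> : col i (of_cols f) = f i by [].
by apply/matrixP => j k; rewrite !mxE (ord1 k).
Qed.

Lemma ler_normv x y : (forall i, 0 <= x i 0 <= y i 0) -> normv x <= normv y.
Proof.
move=> xy; rewrite ler_wsqrtr// ler_sum// => i _.
by have /andP[x0 xyi] := xy i; rewrite ler_pM.
Qed.

Lemma ler_normM_of_colsD (f g h : 'I_m -> 'cV[R]_m) :
  (forall i, f i = g i + h i) ->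
  normM (of_cols f) <= normM (of_cols g) + normM (of_cols h).
Proof.
move=> fgh; rewrite !normM_of_cols (le_trans _ (ler_normvD _ _))// ler_normv// => i.
by rewrite !mxE normv_ge0/= fgh ler_normvD.
Qed.

Lemma normv_col_le (f : 'I_m -> 'cV[R]_m) i : normv (f i) <= normM (of_cols f).
Proof.
have := normv_entry (\col_i normv (f i)) i.
by rewrite normM_of_cols mxE ger0_norm ?normv_ge0.
Qed.

Lemma normM_of_colsZ a (f : 'I_m -> 'cV[R]_m) :
  normM (of_cols (fun i => a *: f i)) = `|a| * normM (of_cols f).
Proof.
rewrite !normM_of_cols -[in RHS](normr_id a) -normvZ; congr normv.
by apply/matrixP => i j; rewrite !mxE normvZ.
Qed.

Lemma normM_of_cols_le_sum (f : 'I_m -> 'cV[R]_m) :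
  normM (of_cols f) <= \sum_i normv (f i).
Proof.
have S0 : 0 <= \sum_i normv (f i) by apply: sumr_ge0 => i _; exact: normv_ge0.
rewrite normM_of_cols -(@ler_pXn2r _ 2) ?nnegrE ?normv_ge0// sqr_normv expr2.
rewrite /dotv mulr_suml ler_sum// => i _; rewrite !mxE ler_wpM2l ?normv_ge0//.
by rewrite (bigD1 i)//= lerDl sumr_ge0// => j _; exact: normv_ge0.
Qed.

Lemma normM_ge0 (M : 'M[R]_m) : 0 <= normM M.
Proof. exact: sqrtr_ge0. Qed.

(* At [normM (of_cols f) = 0] the inverse is the junk value [0], but then [f i = 0]
   and the bound still holds. *)
Lemma normalized_col_dist (f g h : 'I_m -> 'cV[R]_m) i :
  (forall i, f i = g i + h i) -> 0 < normM (of_cols g) ->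
  normv ((normM (of_cols f))^-1 *: f i - (normM (of_cols g))^-1 *: g i)
    <= 2 * normM (of_cols h) / normM (of_cols g).
Proof.
move=> fgh; have := normM_ge0 (of_cols f); have := normv_col_le f i.
have := normv_col_le h i; have := ler_normM_of_colsD fgh.
have : normM (of_cols g) <= normM (of_cols f) + normM (of_cols h).
  have -> : normM (of_cols h) = normM (of_cols (fun i => (-1) *: h i)).
    by rewrite normM_of_colsZ normrN1 mul1r.
  by apply: ler_normM_of_colsD => j; rewrite fgh scaleN1r addrK.
set a := normM (of_cols f); set b := normM (of_cols g); set c := normM (of_cols h).
move=> bac abc hc fa a0 b0.
(* A rescaling error of [f i] plus [h i / b]. Each has norm at most [c / b], the first because
   [|f i| <= a] and [|b - a| <= c]. *)
rewrite (_ : _ - _ = (a^-1 - b^-1) *: f i + b^-1 *: h i); last first.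
  by rewrite scalerBl {3}fgh scalerDr opprD addrA subrK.
rewrite (le_trans (ler_normvD _ _))// !normvZ.
rewrite (_ : 2 * c / b = b^-1 * c + b^-1 * c); last by ring.
rewrite lerD//; last first.
  by rewrite gtr0_norm ?invr_gt0// ler_wpM2l// invr_ge0 ltW.
have [a_eq0|a_neq0] := eqVneq a 0.
  have -> : normv (f i) = 0 by apply/eqP; rewrite eq_le normv_ge0 -a_eq0 fa.
  by rewrite mulr0 mulr_ge0 ?invr_ge0 ?(ltW b0)// normM_ge0.
have ap : 0 < a by rewrite lt0r a_neq0.
apply: (@le_trans _ _ (`|a^-1 - b^-1| * a)); first by rewrite ler_wpM2l.
rewrite -[X in _ * X](gtr0_norm ap) -normrM mulrBl mulVf//.
rewrite (_ : 1 - _ = b^-1 * (b - a)); last by rewrite mulrBr mulVf// gt_eqF.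
rewrite normrM gtr0_norm ?invr_gt0// ler_wpM2l ?invr_ge0 ?(ltW b0)//.
by rewrite ler_norml; apply/andP; split; lra.
Qed.

End EuclideanNorm.

(** * Exponential decay of the flow on [E2] *)

Section Decay.
Variable R : realType.
Implicit Types f g : R -> R.

(** The rate is existential because eigenvalues have different gaps to [s]; a sum keeps the smaller
    rate. The one-sided bound suits norms. *)
Definition exp_decays f : Prop := exists C d : R,
  [/\ 0 <= C, 0 < d & forall t, 0 <= t -> f t <= C * expR (- (d * t))].

Lemma exp_decaysD f g :
  exp_decays f -> exp_decays g -> exp_decays (fun t => f t + g t).
Proof.
move=> [C [d [C0 d0 fC]]] [D [e [D0 e0 gD]]].
exists (C + D), (Num.min d e); split; rewrite ?addr_ge0 ?lt_min ?d0//.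
move=> t t0; rewrite mulrDl lerD//.
  rewrite (le_trans (fC t t0))// ler_wpM2l// ler_expR lerN2 ler_wpM2r//.
  by rewrite ge_min lexx.
rewrite (le_trans (gD t t0))// ler_wpM2l// ler_expR lerN2 ler_wpM2r//.
by rewrite ge_min lexx orbT.
Qed.

Lemma exp_decays_le f g :
  (forall t, 0 <= t -> f t <= g t) -> exp_decays g -> exp_decays f.
Proof.
move=> fg [C [d [C0 d0 gC]]]; exists C, d; split=> // t t0.
exact: le_trans (fg t t0) (gC t t0).
Qed.

Lemma exp_decays0 : exp_decays (fun=> 0).
Proof. by exists 0, 1; split=> // t _; rewrite mul0r. Qed.

Lemma exp_decays_sum (I : Type) (r : seq I) (F : I -> R -> R) :
  (forall i, exp_decays (F i)) -> exp_decays (fun t => \sum_(i <- r) F i t).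
Proof.
move=> FP; elim: r => [|i r IHr].
  by apply: exp_decays_le exp_decays0 => t _; rewrite big_nil.
by apply: exp_decays_le (exp_decaysD (FP i) IHr) => t _; rewrite big_cons.
Qed.

End Decay.

Lemma expmx_E2_decays (R : realType) (m : nat) (A : 'M[R]_m) (z : 'cV[R]_m) :
  perron_like A -> E2 A z ->
  exp_decays (fun t =>
    normv (expR (- (spectral_bound A * t)) *: (expmx (t *: A) *m z))).
Proof.
move=> [_ gap]; set s := spectral_bound A in gap *; move: z; apply: E2_ind.
- by apply: exp_decays_le (exp_decays0 R) => t _; rewrite mulmx0 scaler0 normv0.
- move=> x y xP yP; apply: exp_decays_le (exp_decaysD xP yP) => t _.
  by rewrite mulmxDr scalerDr ler_normvD.
move=> mu z spmu mus [u [[k _ uk] zE]].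
have res : complex.Re mu < s by exact: gap.
(* The midpoint leaves half of the gap to absorb the polynomial factors in the growth bound and half
   as the decay rate [s - b]. *)
pose b := (complex.Re mu + s) / 2.
have mub : complex.Re mu < b by rewrite /b; lra.
have bs : 0 < s - b by rewrite /b; lra.
have [C C0 HC] := expmx_geigen_growth mub uk.
exists (Num.sqrt C), (s - b); split=> // t t0.
(* As the real or imaginary part of [u], [z] contributes one of the two nonnegative summands of the
   bounded energy. *)
have zC : dotv (expmx (t *: A) *m z) (expmx (t *: A) *m z) <= C * expR (2 * b * t).
  by apply: le_trans (HC t t0); case: zE => ->; rewrite ?lerDl ?lerDr dotv_ge0.
rewrite normvZ ger0_norm ?expR_ge0//.
rewrite (_ : - ((s - b) * t) = - (s * t) + b * t); last by ring.
rewrite expRD mulrCA ler_wpM2l ?expR_ge0//.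
rewrite -(@ler_pXn2r _ 2) ?nnegrE ?normv_ge0 ?mulr_ge0 ?sqrtr_ge0 ?expR_ge0//.
rewrite sqr_normv exprMn sqr_sqrtr// -expRM_natl.
by rewrite mulrA.
Qed.

(** * Lower bound from the left eigenvector, and the final estimate *)

(** A row vanishing on a basis vanishes on the coordinate vectors, so all its entries are zero. *)
Lemma basis_row_neq0 (R : fieldType) (m : nat) (v : 'I_m -> 'cV[R]_m)
    (l : 'rV[R]_m) :
  basis_of fullv [tuple v i | i < m] -> l != 0 -> exists i, l *m v i != 0.
Proof.
move=> hv l0; apply/existsP; apply: contraNT l0; rewrite negb_exists.
move=> /forallP lv; apply/eqP/matrixP => i j; rewrite (ord1 i) {i} mxE.
have : l *m (delta_mx j 0 : 'cV[R]_m) = 0.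
  rewrite (coord_basis hv (memvf (delta_mx j 0))) mulmx_sumr big1// => k _.
  rewrite -scalemxAr (nth_map k) ?size_enum_ord// nth_ord_enum.
  by have /negPn/eqP -> := lv k; rewrite scaler0.
by rewrite -colE => /matrixP/(_ 0 0); rewrite !mxE.
Qed.

Lemma normv_mulmx_le (R : realType) (m : nat) (l : 'rV[R]_m) (x : 'cV[R]_m) :
  `|(l *m x) 0 0| <= (\sum_j `|l 0 j|) * normv x.
Proof.
rewrite mxE (le_trans (ler_norm_sum _ _ _))// mulr_suml ler_sum// => j _.
by rewrite normrM ler_wpM2l// normv_entry.
Qed.

Unset Implicit Arguments.

Theorem theorem3p2 (R : realType) (m : nat) (A : 'M[R]_m)
    (v : 'I_m -> 'cV[R]_m)
    (hA : perron_like A)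
    (hv : basis_of fullv [tuple v i | i < m]) :
  let y := fun i => Pi1 A (v i) in
  let x := fun i (t : R) => expmx (t *: A) *m v i in
  let X := fun t : R => of_cols (fun i => x i t) in
  let QY := fun t : R => of_cols (fun i => charQ A (y i) t) in
  exists B0 delta : R, 0 < B0 /\ 0 < delta /\
    forall (t : R) (i : 'I_m), 1 <= t ->
      normv ((normM (X t))^-1 *: x i t
             - (normM (QY t))^-1 *: charQ A (y i) t)
      <= B0 * expR (- (delta * t)).
Proof.
move=> y x X QY; pose s := spectral_bound A.
have [l l0 lA] := perron_like_left_eigenvector hA.
have [i0 lv0] := basis_row_neq0 hv l0.
have Ey i : E1 A (y i) by have [] := Pi1_spec A (v i).
have Ez i : E2 A (v i - y i) by have [] := Pi1_spec A (v i).
pose z i t := expR (- (s * t)) *: (expmx (t *: A) *m (v i - y i)).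
pose x' i t := expR (- (s * t)) *: x i t.
have x'E i t : x' i t = charQ A (y i) t + z i t.
  rewrite /x' /x /z mulmxBr (expmx_charQ _ (Ey i)) scalerBr scalerA -expRD.
  by rewrite addNr expR0 scale1r addrC subrK.
have lz i : l *m (v i - y i) = 0.
  move: (Ez i); apply: (E2_ind (P := fun z => l *m z = 0)).
  - by rewrite mulmx0.
  - by move=> ? ? p q; rewrite mulmxDr p q addr0.
  - by move=> mu w _ mus; apply: left_eigen_GE_complex lA mus.
have lQ i t : l *m charQ A (y i) t = l *m v i.
  rewrite left_eigen_charQ//; apply/eqP.
  by rewrite eq_sym -subr_eq0 -mulmxBr lz.
pose kappa := `|(l *m v i0) 0 0|; pose L := \sum_j `|l 0 j|.
have kappa0 : 0 < kappa.
  rewrite normr_gt0; apply: contraNneq lv0 => lv0.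
  by apply/eqP/matrixP => i j; rewrite (ord1 i) (ord1 j) lv0 mxE.
have QL t : kappa <= L * normM (QY t).
  rewrite /kappa -(lQ i0 t) (le_trans (normv_mulmx_le _ _))//.
  rewrite ler_wpM2l ?sumr_ge0//.
  exact: (normv_col_le (fun i => charQ A (y i) t)).
have L0 : 0 < L.
  have := QL 0; rewrite lt0r sumr_ge0// andbT.
  by apply: contraTneq => ->; rewrite mul0r -ltNge.
have Q0 t : 0 < normM (QY t).
  by rewrite -(pmulr_rgt0 _ L0) (lt_le_trans kappa0).
have [C [d [C0 d0 HC]]] : exp_decays (fun t => normM (of_cols (z^~ t))).
  apply: exp_decays_le (exp_decays_sum (index_enum 'I_m) (fun i =>
    expmx_E2_decays hA (Ez i))) => t _.
  exact: normM_of_cols_le_sum.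
(* From [kappa <= L * normM (QY t)], the factor [2 / normM (QY t)] is at most [K], uniformly in
   [t]. *)
pose K := 2 * L / kappa.
have K0 : 0 < K by rewrite divr_gt0// mulr_gt0.
(* [C] may be [0]; adding [1] makes [B0] strictly positive. *)
exists (K * (C + 1)), d; split; [|split=> //].
  by rewrite mulr_gt0// ltr_wpDl.
move=> t i t1; have t0 : 0 <= t by rewrite (le_trans _ t1).
(* Normalization is invariant under the positive scalar [e^{-st}]. *)
rewrite (_ : (normM (X t))^-1 *: x i t =
    (normM (of_cols (x'^~ t)))^-1 *: x' i t); last first.
  rewrite normM_of_colsZ ger0_norm ?expR_ge0// scalerA invfM mulrAC.
  by rewrite mulVf ?mul1r// gt_eqF ?expR_gt0.
rewrite (le_trans (normalized_col_dist _ (x'E^~ t) (Q0 t)))//.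
apply: (@le_trans _ _ (K * normM (of_cols (z^~ t)))).
  rewrite -/(QY t) ler_pdivrMr//.
  rewrite (_ : K * _ * _ =
    2 * normM (of_cols (z^~ t)) * (L * normM (QY t) / kappa)).
    by rewrite ler_peMr ?mulr_ge0 ?normM_ge0// ler_pdivlMr// mul1r.
  by rewrite /K; ring.
rewrite -[leRHS]mulrA ler_wpM2l ?(ltW K0)// (le_trans (HC t t0))//.
by rewrite ler_wpM2r ?expR_ge0// lerDl.
Qed.
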